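(* Let $\ell\ge 2$ and let $G$ be the visibility graph of a set of $n\ge 2$ points in the plane, at most $\ell$ of which are collinear. Then $G$ is $\lceil\frac{n-1}{\ell-1}\rceil$-edge-connected; moreover, between each pair of distinct vertices of $G$ there are $\lceil\frac{n-1}{\ell-1}\rceil$ pairwise edge-disjoint $1$-bend paths. This bound is best possible: there exist such point sets whose visibility graph has a vertex of degree exactly $\frac{n-1}{\ell-1}$.
   Context: For a finite set $P$ of points in the plane, two distinct points $v,w$ are visible with respect to $P$ if no point of $P$ lies in the open line segment $vw$. The visibility graph of $P$ has vertex set $P$, with $v,w$ adjacent iff they are visible with respect to $P$. Edges of a visibility graph are drawn as straight segments. A $1$-bend path between $v$ and $w$ is a path in the visibility graph whose drawing is a polygonal curve from $v$ to $w$ with at most one bend, i.e. either it consists of the consecutive points of $P$ along the segment $vw$, or there is a point $x\in P$ such that the path consists of the consecutive points of $P$ along the segment $vx$ followed by those along the segment $xw$. *)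

(* Defs.v *)
From HB Require Import structures.
From mathcomp Require Import all_boot all_order all_algebra.
From mathcomp Require Import finmap.
From mathcomp Require Import boolp reals.

Set Implicit Arguments.
Unset Strict Implicit.
Unset Printing Implicit Defensive.

Import Order.TTheory GRing.Theory Num.Theory.

Definition ceil_div (a b : nat) : nat := ((a + b.-1) %/ b)%N.

Lemma ceil_div_leq (a b m : nat) :
  (0 < b)%N -> (ceil_div a b <= m)%N = (a <= m * b)%N.
Proof.
case: b => // b _; rewrite /ceil_div /=.
by rewrite -ltnS ltn_divLR // mulSn addnC addSn ltnS leq_add2l.
Qed.

Section Graph.
Variables (V : finType) (e : rel V).

(* An (undirected) edge is encoded as the set of its two end-vertices. *)
Definition edges : {set {set V}} :=
  [set f | [exists x, exists y, e x y && (f == [set x; y])]]%SET.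

Definition del_edges (F : {set {set V}}) : rel V :=
  [rel x y | e x y && ([set x; y]%SET \notin F)].

Definition edge_connected (k : nat) : Prop :=
  (1 < #|V|)%N /\
  forall F : {set {set V}}, F \subset edges -> (#|F| < k)%N ->
    forall x y : V, connect (del_edges F) x y.

Definition degree (v : V) : nat := #|[set w | e v w]%SET|.

(* As in path.v, a path is given by its first vertex v and the sequence p of  *)
(* the vertices that follow.                                                  *)
Definition graph_path (v w : V) (p : seq V) : Prop :=
  [/\ path e v p, last v p = w & uniq (v :: p)].

Definition path_edges (v : V) (p : seq V) : seq {set V} :=
  pairmap (fun x y => [set x; y]%SET) v p.

Definition edge_disjoint (v : V) (p q : seq V) : bool :=
  [disjoint path_edges v p & path_edges v q].

End Graph.

Local Open Scope fset_scope.
Local Open Scope ring_scope.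

Section Plane.
Variable R : realType.
Local Notation point := 'rV[R]_2.

Definition in_open_segment (v w x : point) : Prop :=
  exists t : R, [/\ 0 < t, t < 1 & x = (1 - t) *: v + t *: w].

Definition in_segment (v w x : point) : Prop :=
  exists t : R, [/\ 0 <= t, t <= 1 & x = (1 - t) *: v + t *: w].

Definition collinear (S : {fset point}) : Prop :=
  exists a d : point, d != 0 /\ forall x, x \in S -> exists t : R, x = a + t *: d.

Definition at_most_collinear (l : nat) (P : {fset point}) : Prop :=
  forall S : {fset point}, S `<=` P -> collinear S -> (#|` S| <= l)%N.

Definition visible (P : {fset point}) (v w : point) : Prop :=
  v <> w /\ forall x, x \in P -> ~ in_open_segment v w x.

Section VisibilityGraph.
Variable P : {fset point}.

Definition visibility_graph : rel P :=
  [rel v w : P | `[< visible P (val v) (val w) >]].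

(* The points of P on the closed segment vw, listed from v to w: x comes      *)
(* before y when x lies on the segment vy.                                    *)
Definition points_along (v w : P) : seq P :=
  sort (fun x y => `[< in_segment (val v) (val y) (val x) >])
       [seq x <- enum {: P} | `[< in_segment (val v) (val w) (val x) >]].

(* The bend x ends the first segment and starts the second one; behead        *)
(* removes its second occurrence.                                             *)
Definition one_bend_path (v w : P) (p : seq P) : Prop :=
  graph_path visibility_graph v w p /\
  (v :: p = points_along v w \/
   exists x : P, v :: p = points_along v x ++ behead (points_along x w)).

End VisibilityGraph.
End Plane.

(* Main.v *)
Require Import Defs.
From HB Require Import structures.
From mathcomp Require Import all_boot all_order all_algebra.
From mathcomp Require Import finmap.
From mathcomp Require Import boolp reals.
From mathcomp Require Import ring lra zify.

Set Implicit Arguments.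
Unset Strict Implicit.
Unset Printing Implicit Defensive.

Import Order.TTheory GRing.Theory Num.Theory.
Local Open Scope fset_scope.
Local Open Scope ring_scope.

(** Fix distinct points [v] and [w].  Send a point [x] off the line [vw] to the
pair (line [vx], line [xw]): this makes these points the edges of a bipartite
graph of maximum degree at most [l - 1], in which a vertex cover therefore has at
least [(n - l) / (l - 1)] elements.  By Koenig's theorem there is a matching of
that size, and the paths [v - x - w] for [x] in the matching, together with the
straight path from [v] to [w], are pairwise edge-disjoint because a common edge
would force two of the lines involved to coincide.

For tightness, put [l - 1] points on each of [k] rays from the origin, at
distances growing so fast that no three points on different rays are collinear;
the origin then sees only the first point on each ray. *)

(** * Koenig's theorem for bipartite multigraphs *)

Section Koenig.
Variables (E A B : finType) (f : E -> A) (g : E -> B).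
Implicit Types (S X : {set E}) (CA : {set A}) (CB : {set B}).

(** Elements of [E] are the edges of a bipartite multigraph, with ends given by [f] and [g]; the
    pair [CA], [CB] is a vertex cover of [S]. *)
Definition covers S CA CB :=
  forall x, x \in S -> (f x \in CA) || (g x \in CB).

Definition matching X := {in X &, injective f} /\ {in X &, injective g}.

Definition cover_number_ge S t :=
  forall CA CB, covers S CA CB -> (t <= #|CA| + #|CB|)%N.

Lemma matching0 : matching set0.
Proof. by split=> x y; rewrite inE. Qed.

(** Left ends lie in [CA] for [X] and outside it for [Y], and right ends are separated by [CB], so
    no end is shared. *)
Lemma matchingU X Y CA CB :
  matching X -> matching Y ->
  (forall x, x \in X -> (f x \in CA) && (g x \notin CB)) ->
  (forall x, x \in Y -> (f x \notin CA) && (g x \in CB)) ->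
  matching (X :|: Y) /\ #|X :|: Y| = (#|X| + #|Y|)%N.
Proof.
move=> [fX gX] [fY gY] hX hY; split; last first.
  apply/eqP; rewrite (leq_card_setU X Y) -setI_eq0.
  apply/eqP/setP=> x; rewrite !inE; apply/negbTE/negP=> /andP[/hX/andP[a _]].
  by move=> /hY/andP[]; rewrite a.
split=> x y /setUP[] hx /setUP[] hy exy.
- exact: fX.
- by have /andP[a _] := hX _ hx; have /andP[] := hY _ hy; rewrite -exy a.
- by have /andP[a _] := hX _ hy; have /andP[] := hY _ hx; rewrite exy a.
- exact: fY.
- exact: gX.
- by have /andP[_ a] := hX _ hx; have /andP[_] := hY _ hy; rewrite -exy (negbTE a).
- by have /andP[_ a] := hX _ hy; have /andP[_] := hY _ hx; rewrite exy (negbTE a).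
- exact: gY.
Qed.

(* A minimum cover meeting both sides splits the problem into two smaller ones:
   the edges met only on the left and the edges met only on the right. *)
Lemma matching_of_mixed_cover S CA CB :
  (forall S' t, (#|S'| < #|S|)%N -> cover_number_ge S' t ->
     exists X, [/\ X \subset S', matching X & (t <= #|X|)%N]) ->
  covers S CA CB -> cover_number_ge S (#|CA| + #|CB|) ->
  CA != set0 -> CB != set0 ->
  exists X, [/\ X \subset S, matching X & (#|CA| + #|CB| <= #|X|)%N].
Proof.
move=> IH cS minS nA nB.
pose S1 := [set x in S | (f x \in CA) && (g x \notin CB)]%SET.
pose S2 := [set x in S | (f x \notin CA) && (g x \in CB)]%SET.
have sub1 : S1 \subset S by apply/fintype.subsetP=> x; rewrite inE => /andP[].
have sub2 : S2 \subset S by apply/fintype.subsetP=> x; rewrite inE => /andP[].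
have lt1 : (#|S1| < #|S|)%N.
  (* If [S1] were all of [S], then [CA] alone would cover [S], and minimality would make [CB]
     empty. *)
  apply/proper_card; rewrite properEneq sub1 andbT; apply: contra_neq nB => e1.
  apply/eqP; rewrite -cards_eq0 -leqn0 -(leq_add2l #|CA|) addn0.
  rewrite (leq_trans (minS CA set0 _)) ?cards0 ?addn0 // => x.
  by rewrite -e1 inE => /and3P[_ ->].
have lt2 : (#|S2| < #|S|)%N.
  apply/proper_card; rewrite properEneq sub2 andbT; apply: contra_neq nA => e2.
  apply/eqP; rewrite -cards_eq0 -leqn0 -(leq_add2r #|CB|) add0n.
  rewrite (leq_trans (minS set0 CB _)) ?cards0 ?add0n // => x.
  by rewrite -e2 inE => /and3P[_ _ ->]; rewrite orbT.
have [|X1 [sX1 mX1 cX1]] := IH S1 #|CA| lt1.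
  (* A cover of [S1] becomes a cover of [S] once [CB] is added on the right. *)
  move=> DA DB cD; rewrite -(leq_add2r #|CB|).
  apply: leq_trans (_ : #|DA| + #|DB :|: CB| <= _)%N; last first.
    by rewrite -addnA leq_add2l; apply: leq_card_setU.
  apply: minS => x xS; rewrite in_setU.
  have := cS x xS; have := cD x; rewrite inE xS /=.
  case: (g x \in CB); rewrite ?orbT // !orbF andbT => h hx.
  exact: h.
have [|X2 [sX2 mX2 cX2]] := IH S2 #|CB| lt2.
  move=> DA DB cD; rewrite -(leq_add2l #|CA|).
  apply: leq_trans (_ : #|CA :|: DA| + #|DB| <= _)%N; last first.
    by rewrite addnA leq_add2r; apply: leq_card_setU.
  apply: minS => x xS; rewrite in_setU.
  have := cS x xS; have := cD x; rewrite inE xS /=.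
  by case: (f x \in CA) => //= h hx; apply: h.
have [mU cU] : matching (X1 :|: X2) /\ #|X1 :|: X2| = (#|X1| + #|X2|)%N.
  apply: (@matchingU X1 X2 CA CB) => // x.
    by move/(fintype.subsetP sX1); rewrite inE => /andP[].
  by move/(fintype.subsetP sX2); rewrite inE => /andP[].
exists (X1 :|: X2); split=> //; last by rewrite cU leq_add.
by rewrite subUset (fintype.subset_trans sX1) // (fintype.subset_trans sX2).
Qed.

(** Induction on [#|S|], deleting an edge [e]. If the cover number drops, a small cover of [S :\ e]
    extends by either end of [e] to a minimum cover of [S]. *)
Theorem koenig S t : cover_number_ge S t ->
  exists X, [/\ X \subset S, matching X & (t <= #|X|)%N].
Proof.
have [m] := ubnP #|S|; elim: m S t => // m IHm S t /ltnSE leSm minS.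
have IH S' t' : (#|S'| < #|S|)%N -> cover_number_ge S' t' ->
    exists X, [/\ X \subset S', matching X & (t' <= #|X|)%N].
  by move=> lt; apply: IHm; apply: leq_trans leSm.
case: t minS => [|t] minS.
  by exists set0; rewrite sub0set cards0; split=> //; apply: matching0.
have [S0|[e eS]] := set_0Vmem S.
  suff: (t < #|@set0 A| + #|@set0 B|)%N by rewrite !cards0.
  by apply: minS => x; rewrite S0 inE.
have ltS : (#|S :\ e| < #|S|)%N by rewrite [X in (_ < X)%N](cardsD1 e) eS.
have [/(IH _ _ ltS)[X [sX mX cX]]|] := pselect (cover_number_ge (S :\ e) t.+1).
  by exists X; split=> //; apply: (fintype.subset_trans sX); apply: subD1set.
move=> /existsNP[CA /existsNP[CB /not_implyP[cC /negP]]].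
rewrite -leqNgt => leC.
have covA : covers S (f e |: CA) CB.
  move=> x xS; have [->|nx] := eqVneq x e; first by rewrite setU11.
  by have := cC x; rewrite !inE nx xS => /(_ isT)/orP[]->; rewrite ?orbT.
have covB : covers S CA (g e |: CB).
  move=> x xS; have [->|nx] := eqVneq x e; first by rewrite setU11 orbT.
  by have := cC x; rewrite !inE nx xS => /(_ isT)/orP[]->; rewrite ?orbT.
have cA : (#|f e |: CA| + #|CB| = t.+1)%N.
  apply/eqP; rewrite eqn_leq minS // andbT cardsU1 -addnA -add1n leq_add //.
  exact: leq_b1.
have cB : (#|CA| + #|g e |: CB| = t.+1)%N.
  apply/eqP; rewrite eqn_leq minS // andbT cardsU1 addnCA -add1n leq_add //.
  exact: leq_b1.
have nonempty (T : finType) (x : T) (C : {set T}) : (x |: C)%SET != set0.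
  by apply/set0Pn; exists x; rewrite setU11.
(* A nonempty side is kept and the end of [e] is added on the other side, which gives a minimum
   cover meeting both sides. *)
have [A0|nA] := eqVneq CA set0; last first.
  by rewrite -cB; apply: matching_of_mixed_cover => //; rewrite cB.
have [B0|nB] := eqVneq CB set0; last first.
  by rewrite -cA; apply: matching_of_mixed_cover => //; rewrite cA.
(* With both sides empty, [t.+1] is 1 and a single edge suffices. *)
exists [set e]; rewrite sub1set eS cards1; split=> //.
  by split=> x y /set1P-> /set1P->.
by rewrite -cB A0 B0 cards0 setU0 cards1.
Qed.
End Koenig.

(** * Sorted sequences, edges of paths and edge-connectivity *)

Section Graphs.
Variables (V : finType) (e : rel V).

Lemma sorted_consecutive (r : rel V) s :
  (forall s1 a b s2, s = s1 ++ a :: b :: s2 -> r a b) -> sorted r s.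
Proof.
case: s => //= a s; elim: s a => //= b s IHs a h; apply/andP; split.
  exact: (h [::] a b s).
by apply: IHs => s1 c d s2 eq; apply: (h (a :: s1) c d s2); rewrite eq.
Qed.

(** Entries before [a] are below it and entries after [b] are above it, so antisymmetry applies.
    This will show that consecutive points on a segment see each other. *)
Lemma sorted_consecutive_between (r : rel V) s1 a b s2 z :
  transitive r -> antisymmetric r -> sorted r (s1 ++ a :: b :: s2) ->
  z \in s1 ++ a :: b :: s2 -> r a z -> r z b -> z = a \/ z = b.
Proof.
move=> tr anti; rewrite sorted_pairwise // pairwise_cat => /and3P[/allrelP h1 _].
move=> /= /and3P[_ /allP h2 _]; rewrite mem_cat !inE => /or4P[zs|/eqP->|/eqP->|zs].
- by move=> az _; left; apply: anti; rewrite az h1 ?mem_head.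
- by left.
- by right.
- by move=> _ zb; right; apply: anti; rewrite zb h2.
Qed.

Lemma path_edges_sub (v : V) p (f : {set V}) :
  f \in path_edges v p -> {subset f <= v :: p}.
Proof.
elim: p v => //= x p IHp v; rewrite inE => /orP[/eqP->|/IHp h] z.
  by rewrite !inE => /orP[]/eqP->; rewrite eqxx ?orbT.
by move/h => hz; rewrite inE hz orbT.
Qed.

(** Since no vertex repeats, an edge is never a singleton; its two ends will determine a line. *)
Lemma path_edges_pair (v : V) p f : uniq (v :: p) -> f \in path_edges v p ->
  exists a b, [/\ a != b, a \in f & b \in f].
Proof.
elim: p v => //= x p IHp v /andP[nv ux]; rewrite inE => /orP[/eqP->|]; last exact: IHp.
exists v, x; rewrite !inE !eqxx orbT; split=> //.
by apply: contraNneq nv => ->; rewrite inE eqxx.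
Qed.

Lemma path_del_edges (F : {set {set V}}) v p :
  path e v p -> [disjoint path_edges v p & F]%B -> path (del_edges e F) v p.
Proof.
elim: p v => //= x p IHp v /andP[evx px]; rewrite disjoint_cons => /andP[nF dF].
rewrite {1}/del_edges /= evx nF; exact: IHp.
Qed.

(* The easy direction of Menger's theorem. *)
Lemma edge_connected_disjoint_paths k :
  (1 < #|V|)%N ->
  (forall v w, v <> w -> exists q : 'I_k -> seq V,
     (forall i, graph_path e v w (q i)) /\
     (forall i j, i <> j -> edge_disjoint v (q i) (q j))) ->
  edge_connected e k.
Proof.
move=> V1 paths; split=> // F _ ltF x y.
have [->|/eqP/paths[q [qP qD]]] := eqVneq x y; first exact: connect0.
have [i di|all_meet] := pickP (fun i => [disjoint path_edges x (q i) & F]%B).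
  have [pq lq _] := qP i.
  by apply/connectP; exists (q i); rewrite ?lq //; apply: path_del_edges.
have meet i : exists f, (f \in path_edges x (q i)) && (f \in F).
  have /negbT := all_meet i; rewrite disjoint_has negbK => /hasP[f f1 f2].
  by exists f; rewrite f1.
pose h i := xchoose (meet i).
have hP i : (h i \in path_edges x (q i)) && (h i \in F) := xchooseP (meet i).
(* If every path met [F], choosing one edge of [F] on each would be injective by disjointness,
   against [#|F| < k]. *)
have inj_h : injective h.
  move=> i j eqh; have [//|/eqP nij] := eqVneq i j.
  have := qD _ _ nij; rewrite /edge_disjoint => /disjointFr.
  have /andP[h1 _] := hP i; have /andP[h2 _] := hP j.
  by move=> /(_ _ h1); rewrite eqh h2.
suff: (k <= #|F|)%N by rewrite leqNgt ltF.
rewrite -[k]card_ord -(card_imset _ inj_h) subset_leq_card //.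
by apply/fintype.subsetP=> _ /imsetP[i _ ->]; case/andP: (hP i).
Qed.

End Graphs.

(** * Orientation determinants and the order of points along a segment *)

Section Segments.
Variable R : realType.
Implicit Types a b c p q r v w x y z : 'rV[R]_2.

Lemma eq_point x y : x 0 0 = y 0 0 -> x 0 1 = y 0 1 -> x = y.
Proof.
move=> e0 e1; apply/rowP=> -[[|[|//]] i].
  by rewrite (_ : Ordinal i = 0) //; apply: val_inj.
by rewrite (_ : Ordinal i = 1) //; apply: val_inj.
Qed.

(** Twice the signed area of the triangle [a b c], so collinearity becomes a polynomial equation. *)
Definition orient a b c : R :=
  (b 0 0 - a 0 0) * (c 0 1 - a 0 1) - (b 0 1 - a 0 1) * (c 0 0 - a 0 0).

(** Each coordinate of [b - a], times [orient p q r], is a combination of the three vanishing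
    determinants, and some coordinate is nonzero. *)
Lemma orient_line a b p q r : a != b ->
  orient a b p = 0 -> orient a b q = 0 -> orient a b r = 0 -> orient p q r = 0.
Proof.
move=> nab hp hq hr.
have h0 : (b 0 0 - a 0 0) * orient p q r = 0.
  have -> : (b 0 0 - a 0 0) * orient p q r =
     (q 0 0 - p 0 0) * (orient a b r - orient a b p)
     - (r 0 0 - p 0 0) * (orient a b q - orient a b p) by rewrite /orient; ring.
  by rewrite hp hq hr; ring.
have h1 : (b 0 1 - a 0 1) * orient p q r = 0.
  have -> : (b 0 1 - a 0 1) * orient p q r =
     (q 0 1 - p 0 1) * (orient a b r - orient a b p)
     - (r 0 1 - p 0 1) * (orient a b q - orient a b p) by rewrite /orient; ring.
  by rewrite hp hq hr; ring.
apply/eqP; apply: contra_neqT nab => nz.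
move/eqP: h0; rewrite mulf_eq0 (negbTE nz) orbF subr_eq0 => /eqP e0.
move/eqP: h1; rewrite mulf_eq0 (negbTE nz) orbF subr_eq0 => /eqP e1.
exact: eq_point.
Qed.

Lemma orient_swap a b c : orient a c b = - orient a b c.
Proof. by rewrite /orient; ring. Qed.

Lemma orient_rot a b c : orient b c a = orient a b c.
Proof. by rewrite /orient; ring. Qed.

Lemma orient_xyy a b : orient a b b = 0.
Proof. by rewrite /orient; ring. Qed.

Lemma orient_xyx a b : orient a b a = 0.
Proof. by rewrite /orient; ring. Qed.

Lemma in_segment_orient v w a b : in_segment v w a -> in_segment v w b ->
  orient a b v = 0 /\ orient a b w = 0.
Proof.
by move=> [t [_ _ ->]] [s [_ _ ->]]; rewrite /orient !mxE; split; ring.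
Qed.

Lemma orient_eq0_param a b c : a != b -> orient a b c = 0 ->
  exists t : R, c = a + t *: (b - a).
Proof.
move=> nab h; have [e0|n0] := eqVneq (b 0 0) (a 0 0).
  have n1 : b 0 1 - a 0 1 != 0.
    by rewrite subr_eq0; apply: contra_neq nab => e1; apply: eq_point.
  exists ((c 0 1 - a 0 1) / (b 0 1 - a 0 1)).
  move/eqP: h; rewrite /orient e0 subrr mul0r sub0r oppr_eq0 mulf_eq0 (negbTE n1) /=.
  rewrite subr_eq0 => /eqP ec.
  by apply: eq_point; rewrite !mxE ?e0 ?ec; [ring|field].
have n1 : b 0 0 - a 0 0 != 0 by rewrite subr_eq0.
exists ((c 0 0 - a 0 0) / (b 0 0 - a 0 0)); apply: eq_point; rewrite !mxE; first by field.
move/eqP: h; rewrite /orient subr_eq0 => /eqP h.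
have e1 : c 0 1 - a 0 1 = (b 0 1 - a 0 1) * (c 0 0 - a 0 0) / (b 0 0 - a 0 0).
  by apply: (canRL (mulfK n1)); rewrite mulrC.
by rewrite -[LHS](subrK (a 0 1)) e1; field.
Qed.

Lemma in_segment_start v w : in_segment v w v.
Proof. by exists 0; rewrite lexx ler01 subr0 scale1r scale0r addr0. Qed.

Lemma in_segment_end v w : in_segment v w w.
Proof. by exists 1; rewrite lexx ler01 subrr scale1r scale0r add0r. Qed.

Lemma in_segment_id v x : in_segment v v x -> x = v.
Proof. by move=> [t [_ _ ->]]; rewrite -scalerDl subrK scale1r. Qed.

(** The parameters multiply. With the antisymmetry and totality proved below, this orders the points
    of a segment by their position from [v]. *)
Lemma in_segment_trans v y x z :
  in_segment v y x -> in_segment v z y -> in_segment v z x.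
Proof.
move=> [t [t0 t1 ->]] [s [s0 s1 ->]]; exists (t * s); split; first exact: mulr_ge0.
  by rewrite mulr_ile1.
by apply: eq_point; rewrite !mxE; ring.
Qed.

(** Substitution gives [y - v = t * s *: (y - v)], so [y = v] unless [t * s = 1], which forces
    [t = 1]. *)
Lemma in_segment_anti v x y : in_segment v y x -> in_segment v x y -> x = y.
Proof.
move=> [t [t0 t1 ex]] [s [s0 s1 ey]].
have [ts|ts] := eqVneq (t * s) 1.
  have t_1 : t = 1.
    apply/eqP; rewrite eq_le t1 -ts ler_piMr //.
  by rewrite ex t_1 subrr scale0r scale1r add0r.
have n : 1 - t * s != 0 by rewrite subr_eq0 eq_sym.
suff ev : y = v by apply: etrans ex _; rewrite ev -scalerDl subrK scale1r.
apply: eq_point; apply: (mulfI n).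
  have : y 0 0 = (1 - s) * v 0 0 + s * ((1 - t) * v 0 0 + t * y 0 0).
    by rewrite [in LHS]ey ex !mxE.
  by move=> h; rewrite mulrBl mul1r [X in X - _]h; ring.
have : y 0 1 = (1 - s) * v 0 1 + s * ((1 - t) * v 0 1 + t * y 0 1).
  by rewrite [in LHS]ey ex !mxE.
by move=> h; rewrite mulrBl mul1r [X in X - _]h; ring.
Qed.

Lemma in_segment_total v w x y : in_segment v w x -> in_segment v w y ->
  in_segment v y x \/ in_segment v x y.
Proof.
suff le_case t s : 0 <= t -> t <= s ->
    in_segment v ((1 - s) *: v + s *: w) ((1 - t) *: v + t *: w).
  move=> [t [t0 t1 ->]] [s [s0 s1 ->]].
  by have [ts|/ltW st] := leP t s; [left|right]; apply: le_case.
(* Settling [t = s] first leaves [0 < s], so the ratio [t / s] can serve as parameter. *)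
move=> t0; rewrite le_eqVlt => /predU1P[->|lts]; first exact: in_segment_end.
have s0 : 0 < s := le_lt_trans t0 lts.
have n := lt0r_neq0 s0.
exists (t / s); split; first by rewrite divr_ge0 // ltW.
  by rewrite ler_pdivrMr // mul1r ltW.
by apply: eq_point; rewrite !mxE; field.
Qed.

Lemma in_open_segment_between v a b z :
  in_segment v b a -> in_open_segment a b z ->
  in_segment v z a /\ in_segment v b z.
Proof.
move=> [t [t0 t1 ->]] [s [s0 s1 ->]].
have [->|nt] := eqVneq t 0.
  rewrite subr0 scale1r scale0r addr0; split; first exact: in_segment_start.
  by exists s; split; rewrite ?ltW.
have tp : 0 < t by rewrite lt_def nt.
have up : 0 < (1 - s) * t + s.
  by apply: addr_gt0 => //; apply: mulr_gt0; rewrite ?subr_gt0.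
have h1 : 0 <= s * (1 - t) by rewrite mulr_ge0 ?subr_ge0 // ltW.
have h2 : 0 <= (1 - s) * (1 - t) by rewrite mulr_ge0 ?subr_ge0 // ltW.
split.
  (* From [v] to [b], the parameter of [a] is [t] and that of [z] is [(1 - s) * t + s]. *)
  exists (t / ((1 - s) * t + s)); split; first by rewrite divr_ge0 // ltW.
    rewrite ler_pdivrMr // mul1r; lra.
  by apply: eq_point; rewrite !mxE; field; rewrite lt0r_neq0.
exists ((1 - s) * t + s); split; [exact: ltW|lra|].
by apply: eq_point; rewrite !mxE; ring.
Qed.

Lemma in_open_segment_neq a b z : a <> b -> in_open_segment a b z -> z <> a /\ z <> b.
Proof.
move=> nab [s [s0 s1 ez]]; split=> ezz; apply: nab.
- have h i : s * (b 0 i - a 0 i) = 0.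
    have := congr1 (fun u : 'rV[R]_2 => u 0 i) ez; rewrite ezz !mxE; lra.
  by apply: eq_point; apply/eqP; rewrite eq_sym -subr_eq0;
     have /eqP := h 0; have /eqP := h 1; rewrite !mulf_eq0 (gt_eqF s0).
- have h i : (1 - s) * (b 0 i - a 0 i) = 0.
    have := congr1 (fun u : 'rV[R]_2 => u 0 i) ez; rewrite ezz !mxE; lra.
  have n1 : 1 - s == 0 = false by apply: gt_eqF; rewrite subr_gt0.
  by apply: eq_point; apply/eqP; rewrite eq_sym -subr_eq0;
     have /eqP := h 0; have /eqP := h 1; rewrite !mulf_eq0 n1.
Qed.

Lemma collinear_orient (S : {fset 'rV[R]_2}) a b c :
  collinear S -> a \in S -> b \in S -> c \in S -> orient a b c = 0.
Proof.
move=> [p [d [_ h]]] /h[t1 ->] /h[t2 ->] /h[t3 ->].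
by rewrite /orient !mxE; ring.
Qed.

End Segments.

(** * Straight and 1-bend paths in the visibility graph *)

Section OneBendPaths.
Variables (R : realType) (P : {fset 'rV[R]_2}).
Implicit Types v w x y : P.

Lemma mem_points_along v w a :
  (a \in points_along v w) = `[< in_segment (val v) (val w) (val a) >].
Proof. by rewrite mem_sort mem_filter mem_enum andbT. Qed.

(** A point of [P] blocking two consecutive entries would itself be on the segment, hence in the
    sorted list and strictly between them. *)
Lemma points_alongP v w : exists p,
  [/\ points_along v w = v :: p, path (@visibility_graph R P) v p,
      last v p = w & uniq (v :: p)].
Proof.
pose r := [rel x y : P | `[< in_segment (val v) (val y) (val x) >]].
have tr : transitive r.
  move=> y x z /asboolP xy /asboolP yz; apply/asboolP.
  exact: in_segment_trans xy yz.
have anti : antisymmetric r.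
  move=> x y /andP[/asboolP xy /asboolP yx]; apply: val_inj.
  exact: in_segment_anti xy yx.
have memE := mem_points_along v w.
have us : uniq (points_along v w) by rewrite sort_uniq filter_uniq ?enum_uniq.
have ss : sorted r (points_along v w).
  (* Totality of [r] is available only among points of the segment [vw], so sorting is done relative
     to that predicate. *)
  apply: (@sort_sorted_in _ [pred x : P | `[< in_segment (val v) (val w) (val x) >]]).
    move=> x y /asboolP xs /asboolP ys; apply/orP.
    by case: (in_segment_total xs ys) => h; [left|right]; apply/asboolP.
  by apply/allP=> x; rewrite mem_filter => /andP[].
have vs : sorted (@visibility_graph R P) (points_along v w).
  apply: sorted_consecutive => s1 a b s2 es.
  have rab : r a b.
    move: ss; rewrite es sorted_pairwise // pairwise_cat => /and3P[_ _ /=].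
    by move=> /andP[/andP[]].
  have nab : val a <> val b.
    move=> /val_inj eab; move: us; rewrite es eab cat_uniq /= inE eqxx.
    by rewrite !andbF.
  apply/asboolP; split=> // z zP zo.
  have [az zb] := in_open_segment_between (asboolW rab) zo.
  have [za zb'] := in_open_segment_neq nab zo.
  have zs : [` zP] \in points_along v w.
    have : b \in points_along v w by rewrite es mem_cat !inE eqxx !orbT.
    rewrite !memE => /asboolP bw; apply/asboolP; exact: in_segment_trans bw.
  have raz : r a [` zP] by apply/asboolP.
  have rzb : r [` zP] b by apply/asboolP.
  rewrite es in ss zs.
  by case: (sorted_consecutive_between tr anti ss zs raz rzb) => /(congr1 val).
have vin : v \in points_along v w by rewrite memE; apply/asboolP/in_segment_start.
have win : w \in points_along v w by rewrite memE; apply/asboolP/in_segment_end.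
case es : (points_along v w) vin => [//|h p] vin.
(* The head precedes [v], hence lies on the degenerate segment from [v] to [v]. *)
have eh : h = v.
  have : (v == h) || r h v.
    move: ss vin; rewrite es sorted_pairwise // inE => /= /andP[/allP hr _].
    by case/orP=> [->//|/hr hv]; apply/orP; right.
  by case/orP=> [/eqP|/asboolP/in_segment_id/val_inj].
subst h; exists p; split=> //; [by rewrite es in vs| |by rewrite es in us].
have : last v p \in points_along v w by rewrite es mem_last.
rewrite memE => /asboolP lw.
have : (w == last v p) || r w (last v p).
  move: win ss; rewrite es; case/lastP: (p) => [|s z].
    by rewrite inE => /eqP->; rewrite eqxx.
  rewrite last_rcons -rcons_cons mem_rcons inE => /orP[->//|ws].
  rewrite sorted_pairwise // -cats1 pairwise_cat allrel1r => /and3P[/allP/(_ _ ws) h _ _].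
  by apply/orP; right.
by case/orP=> [/eqP//|/asboolP wl]; apply: val_inj; apply: in_segment_anti lw wl.
Qed.

(** The first [behead] drops [v], which [graph_path] keeps apart; the second drops the repeated bend
    [x]. *)
Definition bend_path v w x : seq P :=
  behead (points_along v x) ++ behead (points_along x w).

Lemma bend_path_cons v w x :
  v :: bend_path v w x = points_along v x ++ behead (points_along x w).
Proof. by rewrite /bend_path; have [p [-> _ _ _]] := points_alongP v x. Qed.

(* The degenerate bend x = w yields the straight path from v to w. *)
Lemma one_bend_bend_path v w x :
  x = w \/ orient (val v) (val w) (val x) <> 0 -> one_bend_path v w (bend_path v w x).
Proof.
move=> hx; split; last by right; exists x; rewrite bend_path_cons.
have [p [ep pp lp up]] := points_alongP v x.
have [q [eq pq lq uq]] := points_alongP x w.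
have mp a : a \in v :: p -> in_segment (val v) (val x) (val a).
  by rewrite -ep mem_points_along => /asboolP.
have mq a : a \in x :: q -> in_segment (val x) (val w) (val a).
  by rewrite -eq mem_points_along => /asboolP.
rewrite /bend_path ep eq /=; split; first by rewrite cat_path pp lp.
  by rewrite last_cat lp.
rewrite -cat_cons cat_uniq up; move: uq.
rewrite cons_uniq => /andP[nx ->]; rewrite andbT /=.
(* A vertex [a] other than [x] on both legs would put [v] and [w] on the line [ax]; if [x = w] the
   second leg has no such vertex. *)
apply/hasPn=> a aq; apply/negP=> /mp ap.
have nax : val a != val x.
  by apply: contraNneq nx => /val_inj <-.
have aw := mq a; rewrite inE aq orbT in aw; have {}aw := aw isT.
case: hx => [exw|]; first by move: aw nax; rewrite exw => /in_segment_id->; rewrite eqxx.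
apply; have [a1 _] := in_segment_orient ap (in_segment_end _ _).
have [_ a2] := in_segment_orient aw (in_segment_start _ _).
exact: orient_line nax a1 a2 (orient_xyy _ _).
Qed.

Lemma path_edges_bend v w x (f : {set P}) : f \in path_edges v (bend_path v w x) ->
  exists a b, [/\ val a != val b, a \in f, b \in f &
    (forall z, z \in f -> in_segment (val v) (val x) (val z)) \/
    (forall z, z \in f -> in_segment (val x) (val w) (val z))].
Proof.
have [p [ep _ lp up]] := points_alongP v x.
have [q [eq _ _ uq]] := points_alongP x w.
rewrite /bend_path ep eq /= /path_edges pairmap_cat lp mem_cat.
case/orP=> hf.
  have [a [b [nab af bf]]] := path_edges_pair up hf.
  exists a, b; split=> //; left=> z /(path_edges_sub hf).
  by rewrite -ep mem_points_along => /asboolP.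
have [a [b [nab af bf]]] := path_edges_pair uq hf.
exists a, b; split=> //; right=> z /(path_edges_sub hf).
by rewrite -eq mem_points_along => /asboolP.
Qed.

(** A common edge spans a line containing a leg of each path. The four choices of legs make [v x y],
    [v w y] (twice) or [w x y] collinear. *)
Lemma bend_path_disjoint v w x y :
  orient (val v) (val w) (val y) <> 0 ->
  orient (val v) (val x) (val y) <> 0 ->
  x = w \/ orient (val w) (val x) (val y) <> 0 ->
  edge_disjoint v (bend_path v w x) (bend_path v w y).
Proof.
move=> oy oxy ox; rewrite /edge_disjoint disjoint_has; apply/hasPn=> f fx.
apply/negP=> fy.
have [a [b [nab af bf hx]]] := path_edges_bend fx.
have [_ [_ [_ _ _ hy]]] := path_edges_bend fy.
have on (c d : P) : (forall z, z \in f -> in_segment (val c) (val d) (val z)) ->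
    orient (val a) (val b) (val c) = 0 /\ orient (val a) (val b) (val d) = 0.
  by move=> h; apply: in_segment_orient; apply: h.
(* For the straight path the second leg is the single point [w], which carries no edge. *)
have nxw : (forall z, z \in f -> in_segment (val x) (val w) (val z)) -> x <> w.
  move=> h exw; move: nab; rewrite exw in h.
  by rewrite (in_segment_id (h _ af)) (in_segment_id (h _ bf)) eqxx.
case: hx => hx; have [h1 h2] := on _ _ hx; case: hy => /on[h3 h4].
- exact/oxy/(orient_line nab).
- exact/oy/(orient_line nab).
- exact/oy/(orient_line nab).
- by case: ox => [/nxw|ox]; [apply|apply/ox/(orient_line nab)].
Qed.
End OneBendPaths.

(** * Vertex covers under a degree bound *)

Lemma leq_card_preim (E A : finType) (f : E -> A) (S : {set E}) (C : {set A}) m :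
  (forall c, c \in C -> #|[set x in S | f x == c]%SET| <= m)%N ->
  (#|[set x in S | f x \in C]%SET| <= #|C| * m)%N.
Proof.
move=> hm; rewrite -sum1_card (partition_big f (mem C)) /=; last first.
  by move=> x; rewrite inE => /andP[].
rewrite -sum_nat_const; apply: leq_sum => c cC; apply: leq_trans (hm c cC).
rewrite sum1dep_card subset_leq_card //; apply/fintype.subsetP=> x.
by rewrite !inE => /andP[/andP[-> _] ->].
Qed.

(** Each vertex of the cover accounts for at most [m] edges, its degree bound. *)
Lemma covers_card (E A B : finType) (f : E -> A) (g : E -> B) (S : {set E}) CA CB m :
  (forall a, #|[set x in S | f x == a]%SET| <= m)%N ->
  (forall b, #|[set x in S | g x == b]%SET| <= m)%N ->
  covers f g S CA CB -> (#|S| <= (#|CA| + #|CB|) * m)%N.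
Proof.
move=> hf hg cS; rewrite mulnDl.
apply: leq_trans (leq_add (leq_card_preim _) (leq_card_preim _)) => //.
apply: leq_trans (leq_card_setU _ _); apply: subset_leq_card.
by apply/fintype.subsetP=> x xS; rewrite !inE xS cS.
Qed.

(** * Lines through two points of [P], and the edge-disjoint paths *)

Section Lines.
Variables (R : realType) (P : {fset 'rV[R]_2}).
Implicit Types v w x y : P.

(** A line is recorded by its trace on [P], so that [line v] and [line w] are end maps into a finite
    type. The trace is all of [P] when [x = v]. *)
Definition line v x : {set P} := [set y | orient (val v) (val x) (val y) == 0]%SET.

Lemma lineP v x y : reflect (orient (val v) (val x) (val y) = 0) (y \in line v x).
Proof. by rewrite inE; apply: eqP. Qed.

Lemma line_sub v x y : x != v -> y \in line v x -> line v x \subset line v y.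
Proof.
move=> nxv /lineP hy; apply/fintype.subsetP=> z /lineP hz; apply/lineP.
by apply: (@orient_line _ (val v) (val x)); rewrite ?orient_xyx // eq_sym.
Qed.

Lemma line_eq v x y : x != v -> y != v -> y \in line v x -> line v x = line v y.
Proof.
move=> nx ny yx; apply/eqP; rewrite eqEsubset line_sub //= line_sub //.
by apply/lineP; move/lineP: yx => yx; rewrite orient_swap yx oppr0.
Qed.

Lemma card_line l v x : at_most_collinear l P -> x != v -> (#|line v x| <= l)%N.
Proof.
move=> hP nxv; pose S := [fset val y | y in line v x].
have -> : #|line v x| = #|` S| by rewrite card_imfset ?cardE //=; exact: val_inj.
apply: hP; first by apply/fsubsetP=> _ /imfsetP[y _ ->]; apply: valP.
exists (val v), (val x - val v); split; first by rewrite subr_eq0.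
move=> _ /imfsetP[y /lineP hy ->]; apply: orient_eq0_param => //.
by rewrite eq_sym.
Qed.

(** A nonempty fibre lies on one line through [v]; that line also contains [v], which is outside
    [S], hence [l - 1]. *)
Lemma card_line_fibre l v (S c : {set P}) : at_most_collinear l P -> v \notin S ->
  (#|[set x in S | line v x == c]%SET| <= l - 1)%N.
Proof.
move=> hP vS; have [->|[x]] := set_0Vmem [set x in S | line v x == c]%SET.
  by rewrite cards0.
rewrite inE => /andP[xS /eqP ex].
have nxv : x != v by apply: contraNneq vS => <-.
have vx : v \in line v x by apply/lineP; rewrite orient_xyx.
rewrite leq_subRL; last by apply: leq_trans (card_line hP nxv); apply/card_gt0P; exists v.
apply: leq_trans (card_line hP nxv); rewrite [leqRHS](cardsD1 v) vx leq_add2l.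
apply: subset_leq_card; apply/fintype.subsetP=> y; rewrite !in_setD1 inE.
move=> /andP[yS /eqP ey]; apply/andP; split; first by apply: contraNneq vS => <-.
by rewrite ex -ey; apply/lineP; rewrite orient_xyy.
Qed.

Lemma matching_lines l v w : (2 <= l)%N -> at_most_collinear l P -> v != w ->
  exists X : {set P}, [/\ X \subset ~: line v w, matching (line v) (line w) X &
    (ceil_div (#|` P| - 1) (l - 1) <= #|X|.+1)%N].
Proof.
move=> hl hP nvw.
have vS : v \notin ~: line v w.
  by rewrite in_setC negbK; apply/lineP; rewrite orient_xyx.
have wS : w \notin ~: line v w.
  by rewrite in_setC negbK; apply/lineP; rewrite orient_xyy.
have l1 : (0 < l - 1)%N by rewrite subn_gt0.
(* The predecessor leaves room for the straight path. At most [l] points are on [line v w], so a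
   cover of size [c] gives [n <= l + c * (l - 1)], that is, [n - 1 <= (c + 1) * (l - 1)]. *)
have [|X [sX mX cX]] :=
  @koenig _ _ _ (line v) (line w) (~: line v w) (ceil_div (#|` P| - 1) (l - 1)).-1.
  move=> CA CB cC; have := @covers_card _ _ _ (line v) (line w) (~: line v w) CA CB (l - 1).
  move=> /(_ (fun c => card_line_fibre c hP vS) (fun c => card_line_fibre c hP wS) cC).
  have nwv : w != v by rewrite eq_sym.
  have := card_line hP nwv; have := cardsC (line v w); rewrite -cardfE.
  rewrite -subn1 leq_subLR ceil_div_leq // add1n mulSn.
  move: #|line v w| #|~: line v w| ((_ + _) * _)%N #|` P| => a b d N.
  lia.
exists X; split=> //; by rewrite -subn1 leq_subLR add1n in cX.
Qed.

Lemma disjoint_one_bend_paths l v w :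
  (2 <= l)%N -> at_most_collinear l P -> v <> w ->
  exists q : 'I_(ceil_div (#|` P| - 1) (l - 1)) -> seq P,
    (forall i, one_bend_path v w (q i)) /\
    (forall i j, i <> j -> edge_disjoint v (q i) (q j)).
Proof.
move=> hl hP /eqP nvw; have [X [sX [injv injw] cX]] := matching_lines hl hP nvw.
have offX x : x \in X -> orient (val v) (val w) (val x) <> 0.
  by move/(fintype.subsetP sX); rewrite in_setC => /lineP.
have Xv x : x \in X -> x != v.
  by move/offX=> h; apply/eqP=> exv; apply: h; rewrite exv orient_xyx.
have Xw x : x \in X -> x != w.
  by move/offX=> h; apply/eqP=> exv; apply: h; rewrite exv orient_xyy.
(* The list of bends; the entry [w] stands for the straight path. *)
pose s := w :: enum X.
have us : uniq s.
  by rewrite /= enum_uniq andbT mem_enum; apply/negP=> /Xw; rewrite eqxx.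
have ss : (ceil_div (#|` P| - 1) (l - 1) <= size s)%N by rewrite /= -cardE.
have sP x : x \in s -> x = w \/ x \in X.
  by rewrite inE mem_enum => /orP[/eqP|]; [left|right].
have dis x y : x \in s -> y \in X -> x <> y ->
    edge_disjoint v (bend_path v w x) (bend_path v w y).
  move=> /sP hx yX nxy; apply: bend_path_disjoint; first exact: offX.
    case: hx => [->|xX]; first exact: offX.
    (* Were [v], [x], [y] collinear, [x] and [y] would have the same line through [v], against the
       matching. *)
    by move=> /lineP/(line_eq (Xv _ xX) (Xv _ yX))/injv h; apply/nxy/h.
  case: hx => [->|xX]; [by left|right].
  by move=> /lineP/(line_eq (Xw _ xX) (Xw _ yX))/injw h; apply/nxy/h.
exists (fun i => bend_path v w (nth w s i)); split=> [i|i j nij].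
  apply: one_bend_bend_path.
  have /sP[->|/offX] : nth w s i \in s by rewrite mem_nth // (leq_trans _ ss).
    by left.
  by right.
have iS : nth w s i \in s by rewrite mem_nth // (leq_trans _ ss).
have jS : nth w s j \in s by rewrite mem_nth // (leq_trans _ ss).
have nn : nth w s i <> nth w s j.
  move/eqP; rewrite nth_uniq ?(leq_trans _ ss) // => /eqP h; apply: nij.
  exact: val_inj.
have [jw|jX] := sP _ jS; last exact: dis.
have [iw|iX] := sP _ iS; first by case: nn; rewrite iw jw.
by rewrite /edge_disjoint disjoint_sym; apply: dis => // h; apply: nn.
Qed.
End Lines.

(** * The extremal configuration on [k] rays from the origin *)

Section Extremal.
Variables (R : realType) (k m : nat).
Implicit Types x y z u v w : 'I_k * 'I_m.

(** Here [s] is the slope of the ray and [r] the abscissa, so all computations stay polynomial. *)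
Definition ray_point (s r : R) : 'rV[R]_2 := \row_c (if c == 0 then r else r * s).

Lemma orient_ray_point s1 r1 s2 r2 s3 r3 :
  orient (ray_point s1 r1) (ray_point s2 r2) (ray_point s3 r3) =
  r1 * r2 * (s2 - s1) + r2 * r3 * (s3 - s2) - r1 * r3 * (s3 - s1).
Proof. by rewrite /orient !mxE /=; ring. Qed.

Lemma orient0_ray_point s1 r1 s2 r2 :
  orient 0 (ray_point s1 r1) (ray_point s2 r2) = r1 * r2 * (s2 - s1).
Proof. by rewrite /orient !mxE /=; ring. Qed.

(* The radii grow so fast from one ray to the next that three grid points on
   different rays always turn counterclockwise. *)
Definition radius (x : 'I_k * 'I_m) : R := k.+1%:R ^+ (x.1 * m + x.2).

Definition grid_point (x : 'I_k * 'I_m) : 'rV[R]_2 := ray_point (x.1 : nat)%:R (radius x).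

Definition grid : {fset 'rV[R]_2} :=
  0 |` [fset grid_point x | x in {: 'I_k * 'I_m}].

Lemma base_gt1 (i : 'I_k) : 1 < k.+1%:R :> R.
Proof. by rewrite ltr1n ltnS (leq_ltn_trans _ (ltn_ord i)). Qed.

Lemma radius_gt0 x : 0 < radius x.
Proof. by rewrite exprn_gt0 // ltr0n. Qed.

(** The exponents enumerate the grid ray by ray, so a later ray has a larger exponent, and the base
    [k.+1] exceeds [k]. *)
Lemma radius_lt x y : (x.1 < y.1)%N -> k%:R * radius x < radius y.
Proof.
move=> lt; apply: (@lt_le_trans _ _ (k.+1%:R * radius x)).
  by rewrite ltr_pM2r ?radius_gt0 // ltr_nat.
rewrite -exprS; apply: ler_weXn2l; first exact/ltW/(base_gt1 x.1).
have := ltn_ord x.2; have : (x.1.+1 * m <= y.1 * m)%N by rewrite leq_mul2r lt orbT.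
rewrite mulSn; lia.
Qed.

Lemma radius_lt2 (i : 'I_k) (j j' : 'I_m) : (radius (i, j) < radius (i, j')) = (j < j')%N.
Proof. by rewrite ltr_eXn2l ?base_gt1 //= ltn_add2l. Qed.

Lemma radius_inj (i : 'I_k) : injective (fun j => radius (i, j)).
Proof.
move=> j j' e; case: (ltngtP j j') => [|| /val_inj //].
  by rewrite -(radius_lt2 i) e ltxx.
by rewrite -(radius_lt2 i) e ltxx.
Qed.

Lemma grid_point_neq0 x : grid_point x != 0.
Proof.
apply/eqP=> /(congr1 (fun u : 'rV[R]_2 => u 0 0)); rewrite !mxE /= => h.
by have := radius_gt0 x; rewrite h ltxx.
Qed.

Lemma grid_point_inj : injective grid_point.
Proof.
move=> [i j] [i' j'] e.
have := congr1 (fun u : 'rV[R]_2 => u 0 0) e; rewrite !mxE /= => er.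
have := congr1 (fun u : 'rV[R]_2 => u 0 1) e; rewrite !mxE /= er.
move/(mulfI (lt0r_neq0 (radius_gt0 _)))/eqP; rewrite eqr_nat => /eqP/val_inj ei.
by move: er; rewrite ei => /radius_inj->.
Qed.

Lemma card_grid : #|` grid| = (k * m).+1.
Proof.
rewrite cardfsU1 (_ : 0 \notin _); last first.
  by apply/imfsetP=> -[x _ h]; have := grid_point_neq0 x; rewrite -h eqxx.
by rewrite card_imfset /=; [rewrite -cardE card_prod !card_ord|exact: grid_point_inj].
Qed.

Lemma grid_point_in x : grid_point x \in grid.
Proof. by apply/fset1UP; right; apply/imfsetP; exists x. Qed.

Lemma gridP p : p \in grid -> p = 0 \/ exists x, p = grid_point x.
Proof. by case/fset1UP=> [|/imfsetP[x _ ->]]; [left|right; exists x]. Qed.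

(** Slopes on different rays differ by at least 1 and at most [k], so [r2 * r3 * (s3 - s2) >= r2 *
    r3 > k * r1 * r3], which dominates the only negative term. *)
Lemma orient_grid_point_gt0 x y z : (x.1 < y.1)%N -> (y.1 < z.1)%N ->
  0 < orient (grid_point x) (grid_point y) (grid_point z).
Proof.
move=> xy yz; rewrite orient_ray_point.
have hxy := radius_lt xy; have x0 := radius_gt0 x; have y0 := radius_gt0 y.
have z0 := radius_gt0 z.
have sxy : ((x.1 : nat)%:R : R) + 1 <= (y.1 : nat)%:R by rewrite natr1 ler_nat.
have syz : ((y.1 : nat)%:R : R) + 1 <= (z.1 : nat)%:R by rewrite natr1 ler_nat.
have szk : ((z.1 : nat)%:R : R) - (x.1 : nat)%:R <= k%:R.
  by rewrite lerBlDr -natrD ler_nat (leq_trans (ltnW (ltn_ord _))) ?leq_addr.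
move: hxy x0 y0 z0 sxy syz szk.
move: (radius x) (radius y) (radius z) (x.1%:R) (y.1%:R) (z.1%:R) => r1 r2 r3 s1 s2 s3.
move=> hxy x0 y0 z0 sxy syz szk.
have h1 : 0 < r1 * r2 * (s2 - s1) by rewrite mulr_gt0 ?mulr_gt0 //; lra.
have h2 : r2 * r3 <= r2 * r3 * (s3 - s2).
  by apply: ler_peMr; [rewrite mulr_ge0 ?ltW|lra].
have h3 : r1 * r3 * (s3 - s1) <= k%:R * r1 * r3.
  by rewrite -[leRHS]mulrA [leRHS]mulrC ler_pM2l ?mulr_gt0.
have h4 : k%:R * r1 * r3 < r2 * r3 by rewrite ltr_pM2r.
lra.
Qed.

Lemma orient_grid_point_neq0 x y z : x.1 != y.1 -> y.1 != z.1 -> x.1 != z.1 ->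
  orient (grid_point x) (grid_point y) (grid_point z) != 0.
Proof.
rewrite -!val_eqE /= !neq_ltn.
have o u v w : (u.1 < v.1)%N -> (v.1 < w.1)%N ->
    orient (grid_point u) (grid_point v) (grid_point w) != 0.
  by move=> uv vw; rewrite lt0r_neq0 ?orient_grid_point_gt0.
have sw u v w : (orient (grid_point u) (grid_point w) (grid_point v) != 0) =
    (orient (grid_point u) (grid_point v) (grid_point w) != 0).
  by rewrite orient_swap oppr_eq0.
have rot u v w : orient (grid_point v) (grid_point w) (grid_point u) =
    orient (grid_point u) (grid_point v) (grid_point w) := orient_rot _ _ _.
(* Of the eight sign patterns two are cyclic and absurd; the others reduce to increasing order by
   permuting the arguments. *)
case/orP=> xy /orP[] yz /orP[] xz.
- exact: o.
- by have := ltn_trans (ltn_trans xy yz) xz; rewrite ltnn.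
- by rewrite sw o.
- by rewrite (rot z x y) o.
- by rewrite sw (rot y x z) o.
- by rewrite -(rot x y z) o.
- by have := ltn_trans (ltn_trans yz xy) xz; rewrite ltnn.
- by rewrite sw (rot y x z) (rot z y x) o.
Qed.

(** The determinant factors as the radius of [y] times a difference of radii times a difference of
    slopes. *)
Lemma orient_same_ray (i : 'I_k) (j j' : 'I_m) y :
  orient (grid_point (i, j)) (grid_point (i, j')) (grid_point y) = 0 ->
  y.1 != i -> j = j'.
Proof.
rewrite orient_ray_point /= => h ny.
have {}h : radius y * (radius (i, j') - radius (i, j)) * ((y.1 : nat)%:R - (i : nat)%:R) = 0.
  by rewrite -h; ring.
move/eqP: h; rewrite !mulf_eq0 (gt_eqF (radius_gt0 _)) /= !subr_eq0 eqr_nat.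
by rewrite val_eqE (negbTE ny) orbF => /eqP/radius_inj.
Qed.

Lemma at_most_collinear_grid : (0 < m)%N -> at_most_collinear m.+1 grid.
Proof.
move=> m0 S sS cS.
(* A line meeting two rays away from the origin contains only those two grid points; otherwise [S]
   lies on one ray together with the origin. *)
have [[x [y [xS yS nxy]]]|same] := pselect (exists x y,
    [/\ grid_point x \in S, grid_point y \in S & x.1 != y.1]).
  apply: leq_trans (_ : 2 <= _)%N => //.
  have : S `<=` [fset grid_point x; grid_point y].
    apply/fsubsetP=> p pS; have [p0|[z ez]] := gridP (fsubsetP sS p pS).
      have := collinear_orient cS pS xS yS; rewrite p0 orient0_ray_point => /eqP.
      rewrite !mulf_eq0 !(gt_eqF (radius_gt0 _)) /= subr_eq0 eqr_nat val_eqE eq_sym.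
      by rewrite (negbTE nxy).
    rewrite ez in pS *; have o := collinear_orient cS xS yS pS.
    have [zx|nzx] := eqVneq z.1 x.1.
      have := @orient_same_ray x.1 x.2 z.2 y; rewrite -{2}zx -!surjective_pairing eq_sym.
      rewrite orient_swap o oppr0 => /(_ erefl nxy) ej.
      by rewrite (_ : z = x) ?fset21 //; case: (z) (x) zx ej => ? ? [? ?] /= -> ->.
    have [zy|nzy] := eqVneq z.1 y.1.
      have := @orient_same_ray y.1 y.2 z.2 x; rewrite -{2}zy -!surjective_pairing.
      rewrite orient_rot o => /(_ erefl nxy) ej.
      by rewrite (_ : z = y) ?fset22 //; case: (z) (y) zy ej => ? ? [? ?] /= -> ->.
    have := @orient_grid_point_neq0 x y z nxy; rewrite o eqxx.
    by rewrite eq_sym nzy eq_sym nzx => /(_ isT isT).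
  by move/fsubset_leq_card=> /leq_trans; apply; rewrite cardfs2; case: (_ != _).
have [[x xS]|none] := pselect (exists x, grid_point x \in S); last first.
  have : S `<=` [fset 0].
    apply/fsubsetP=> p pS; apply/fset1P.
    have [//|[z ez]] := gridP (fsubsetP sS p pS); case: none; exists z.
    by rewrite -ez.
  by move/fsubset_leq_card/leq_trans; apply; rewrite cardfs1.
have : S `<=` 0 |` [fset grid_point (x.1, j) | j in 'I_m].
  apply/fsubsetP=> p pS; apply/fset1UP.
  have [|[[i j] ez]] := gridP (fsubsetP sS p pS); [by left|right].
  apply/imfsetP; exists j => //; rewrite ez; congr (grid_point (_, _)).
  apply/eqP/negPn/negP=> n; apply: same; exists (i, j), x; split=> //.
  by rewrite -ez.
move/fsubset_leq_card/leq_trans; apply.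
rewrite cardfsU1 -(add1n m) leq_add ?leq_b1 //.
by apply: leq_trans (leq_imfset_card _ _ _) _; rewrite /= -cardE card_ord.
Qed.

Lemma in_open_segment0 (p q : 'rV[R]_2) :
  in_open_segment 0 p q <-> exists t : R, [/\ 0 < t, t < 1 & q = t *: p].
Proof. by split=> -[t [t0 t1 ->]]; exists t; rewrite scaler0 add0r. Qed.

Lemma scale_ray_point (t s r : R) : t *: ray_point s r = ray_point s (t * r).
Proof. by apply: eq_point; rewrite !mxE //= mulrA. Qed.

(** The first point of a ray hides the later ones. A point hiding the first would have the same
    slope and a smaller radius. *)
Lemma visible_origin (m0 : (0 < m)%N) x :
  visible grid 0 (grid_point x) <-> x.2 = Ordinal m0.
Proof.
case: x => i j /=; split=> [[_ vis]|->].
  apply/eqP/negPn/negP=> nj; have j0 : (Ordinal m0 < j)%N.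
    by rewrite lt0n; apply: contra nj => /eqP ej; apply/eqP/val_inj.
  have r0 := radius_gt0 (i, j).
  apply: (vis (grid_point (i, Ordinal m0))).
    exact: grid_point_in.
  apply/in_open_segment0; exists (radius (i, Ordinal m0) / radius (i, j)); split.
  - by rewrite divr_gt0 ?radius_gt0.
  - by rewrite ltr_pdivrMr // mul1r radius_lt2.
  - by rewrite scale_ray_point divfK // gt_eqF.
split; first by move=> h; have := grid_point_neq0 (i, Ordinal m0); rewrite -h eqxx.
move=> p /gridP[->|[[i' j'] ->]] /in_open_segment0[t [t0 t1]].
  move/eqP; rewrite eq_sym scaler_eq0 (gt_eqF t0) /=.
  by rewrite (negbTE (grid_point_neq0 _)).
rewrite scale_ray_point => e.
have := congr1 (fun u : 'rV[R]_2 => u 0 0) e; rewrite !mxE /= => er.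
have := congr1 (fun u : 'rV[R]_2 => u 0 1) e; rewrite !mxE /= -er.
move/(mulfI (lt0r_neq0 (radius_gt0 _)))/eqP; rewrite eqr_nat => /eqP/val_inj ei.
have : radius (i, j') < radius (i, Ordinal m0).
  by rewrite -ei er ei gtr_pMl ?radius_gt0.
by rewrite radius_lt2.
Qed.

Lemma degree_origin : (0 < m)%N ->
  degree (@visibility_graph R grid) [` fset1U1 0 _] = k.
Proof.
move=> m0; rewrite /degree; pose h (i : 'I_k) : grid := [` grid_point_in (i, Ordinal m0)].
have inj_h : injective h.
  by move=> i i' /(congr1 val)/grid_point_inj[].
rewrite -[RHS]card_ord -(card_imset _ inj_h); apply: eq_card => w.
rewrite inE /=; apply/asboolP/imsetP=> [vis|[i _ ->]]; last exact/visible_origin.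
have [w0|[[i j] ew]] := gridP (valP w); first by case: vis => /(_ (esym w0)).
exists i => //; apply: val_inj; rewrite /= ew; congr (grid_point (_, _)).
by move: vis; rewrite ew => /(visible_origin m0).
Qed.

End Extremal.

Theorem theorem4 (R : realType) (l : nat) (hl : (2 <= l)%N) :
  (forall (n : nat) (P : {fset 'rV[R]_2}),
      (2 <= n)%N -> #|` P| = n -> at_most_collinear l P ->
      edge_connected (@visibility_graph R P) (ceil_div (n - 1) (l - 1)) /\
      (forall v w : P, v <> w ->
         exists q : 'I_(ceil_div (n - 1) (l - 1)) -> seq P,
           (forall i, one_bend_path v w (q i)) /\
           (forall i j, i <> j -> edge_disjoint v (q i) (q j))))
  /\
  (forall n : nat, (2 <= n)%N -> (l - 1 %| n - 1)%N ->
     exists P : {fset 'rV[R]_2},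
       [/\ #|` P| = n, at_most_collinear l P &
           exists v : P,
             degree (@visibility_graph R P) v = ((n - 1) %/ (l - 1))%N]).
Proof.
split=> [n P n2 card_P hP|n n2 dvd].
  have paths v w := @disjoint_one_bend_paths R P l v w hl hP.
  rewrite -card_P; split=> //; apply: edge_connected_disjoint_paths.
    by rewrite -cardfE card_P.
  by move=> v w /paths[q [qP qD]]; exists q; split=> // i; case: (qP i).
have l1 : (0 < l - 1)%N by rewrite subn_gt0.
(* The origin and [(n - 1) %/ (l - 1)] rays of [l - 1] points make [n] points by divisibility, and
   each ray with the origin has [l]. *)
exists (grid R ((n - 1) %/ (l - 1)) (l - 1)); split.
- by rewrite card_grid divnK // subn1 prednK // ltnW.
- have := @at_most_collinear_grid R ((n - 1) %/ (l - 1)) (l - 1) l1.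
  by rewrite subn1 prednK // ltnW.
- by eexists; apply: degree_origin.
Qed.
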